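(* Let $P$ be a quasicontinuous domain. Then: (1) the upper Vietoris topology agrees with the Scott topology on $\mathsf{K}(\Sigma P)$; (2) $\mathsf{K}(\Sigma P)$ is a continuous semilattice; (3) the Scott power space $\Sigma\,\mathsf{K}(\Sigma P)$ is a sober $c$-space.
   Context: For a poset $P$, a subset $U$ is Scott open if $U$ is an upper set and for every (nonempty) directed $D\subseteq P$ whose supremum $\bigvee D$ exists in $P$, $\bigvee D\in U$ implies $D\cap U\neq\emptyset$; these sets form the Scott topology $\sigma(P)$, and $\Sigma P=(P,\sigma(P))$. For a dcpo $P$ (poset in which every nonempty directed subset has a supremum), $A\subseteq P$ and $x\in P$, $A\ll x$ means that for every directed $D$, $x\le\bigvee D$ implies $D\cap{\uparrow}A\ne\emptyset$, where ${\uparrow}A=\{y: y\ge a\text{ for some }a\in A\}$; $u\ll x$ means $\{u\}\ll x$. A dcpo $P$ is a quasicontinuous domain if for each $x\in P$ the family $\{{\uparrow}F: F\subseteq P\text{ finite}, F\ll x\}$ is filtered (with respect to inclusion) and its intersection is ${\uparrow}x$. A dcpo is a continuous domain if for each $x$ the set $\{u:u\ll x\}$ is directed with supremum $x$; a continuous semilattice is a continuous domain in which every two elements have an infimum. For a $T_0$ space $X$, $\mathsf{K}(X)$ denotes the set of all nonempty compact saturated subsets (saturated: intersection of open sets), ordered by the Smyth order $K_1\sqsubseteq K_2 \iff K_2\subseteq K_1$. The upper Vietoris topology on $\mathsf{K}(X)$ has base $\{\Box U: U \text{ open in } X\}$, where $\Box U=\{K\in\mathsf{K}(X):K\subseteq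 U\}$. The Scott power space of $X$ is $\Sigma\,\mathsf{K}(X)=(\mathsf{K}(X),\sigma(\mathsf{K}(X)))$. A space $Y$ is a $c$-space if for each $y\in Y$ and each open neighborhood $U$ of $y$ there is $u\in Y$ with $y\in\mathrm{int}\,{\uparrow}u\subseteq{\uparrow}u\subseteq U$, with ${\uparrow}u$ taken in the specialization order ($x\le y \iff x\in\overline{\{y\}}$). Sober: every irreducible closed subset is the closure of a unique point. *)

(* Defs.v *)
From HB Require Import structures.
From mathcomp Require Import all_boot all_order.
From mathcomp Require Import all_classical.
From mathcomp Require Import topology_structure compact.

Set Implicit Arguments.
Unset Strict Implicit.
Unset Printing Implicit Defensive.

Import Order.TTheory.
Local Open Scope classical_set_scope.
Local Open Scope order_scope.

Section Posets.
Context {d : Order.disp_t} {P : porderType d}.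
Implicit Types (x y u : P) (A U D F : set P).

Definition directed D :=
  D !=set0 /\ forall x y, D x -> D y -> exists z, [/\ D z, x <= z & y <= z].

Definition upper_set U := forall x y, U x -> x <= y -> U y.

Definition up A : set P := [set y | exists2 a, A a & a <= y].

Definition scott_open U :=
  upper_set U /\
  forall D s, directed D -> isLub D s -> U s -> D `&` U !=set0.

Definition way_below A x :=
  forall D s, directed D -> isLub D s -> x <= s -> D `&` up A !=set0.

End Posets.

Section Domains.
Context {d : Order.disp_t} (P : porderType d).

Definition dcpo := forall D : set P, directed D -> exists s, isLub D s.

Definition fin_way_below (x : P) : set (set P) :=
  [set F | finite_set F /\ way_below F x].

Definition quasicontinuous_domain :=
  dcpo /\
  forall x : P,
    [/\ (* {up F | F finite, F << x} is a filtered family *)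
        fin_way_below x !=set0,
        forall F G : set P, fin_way_below x F -> fin_way_below x G ->
          exists H, [/\ fin_way_below x H, up H `<=` up F & up H `<=` up G] &
        \bigcap_(F in fin_way_below x) up F = up [set x]].

Definition continuous_domain :=
  dcpo /\
  forall x : P, directed [set u | way_below [set u] x] /\
                isLub [set u | way_below [set u] x] x.

Definition continuous_semilattice :=
  continuous_domain /\ forall x y : P, infimums [set x; y] !=set0.

End Domains.

(* P with its Scott topology, written \Sigma P in the literature. *)
Definition scott (P : Type) : Type := P.

Section ScottTopology.
Context {d : Order.disp_t} (P : porderType d).

Lemma scott_openT : scott_open [set: P].
Proof.
split=> // D s [[x Dx] _] _ _; by exists x.
Qed.

Lemma scott_openI : setI_closed (@scott_open d P).
Proof.
move=> U V [Uup US] [Vup VS]; split.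
  by move=> x y [Ux Vx] xy; split; [exact: Uup xy|exact: Vup xy].
move=> D s dD Ds [Us Vs].
have [x [Dx Ux]] := US _ _ dD Ds Us.
have [y [Dy Vy]] := VS _ _ dD Ds Vs.
have [z [Dz xz yz]] := dD.2 x y Dx Dy.
by exists z; split=> //; split; [exact: Uup xz|exact: Vup yz].
Qed.

Lemma scott_open_bigU (I : Type) (f : I -> set P) :
  (forall i, scott_open (f i)) -> scott_open (\bigcup_i f i).
Proof.
move=> fo; split.
  by move=> x y [i _ fx] xy; exists i => //; exact: (fo i).1 xy.
move=> D s dD Ds [i _ fs].
by have [x [Dx fx]] := (fo i).2 _ _ dD Ds fs; exists x; split=> //; exists i.
Qed.

HB.instance Definition _ := Choice.on (scott P).
HB.instance Definition _ :=
  isOpenTopological.Build (scott P) scott_openT scott_openI scott_open_bigU.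

Lemma open_scottE (U : set (scott P)) : open U = scott_open (U : set P).
Proof. by []. Qed.

End ScottTopology.

Definition saturated {X : topologicalType} (A : set X) :=
  exists2 O : set (set X), O `<=` open & A = \bigcap_(U in O) U.

Record Ksat (X : topologicalType) := MkKsat {
  ksat :> set X;
  ksat_neq0 : ksat !=set0;
  ksat_compact : compact ksat;
  ksat_saturated : saturated ksat }.

Section Ksat.
Context {X : topologicalType}.
Implicit Types K L : Ksat X.

Lemma ksat_inj : injective (@ksat X).
Proof.
case=> [K K0 Kc Ks] [L L0 Lc Ls] /= KL; case: _ / KL in L0 Lc Ls *.
by congr MkKsat; exact: Prop_irrelevance.
Qed.

HB.instance Definition _ := gen_eqMixin (Ksat X).
HB.instance Definition _ := gen_choiceMixin (Ksat X).

Definition smyth_le K L : bool := `[< (L : set X) `<=` (K : set X) >].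

Lemma smyth_le_refl : reflexive smyth_le.
Proof. by move=> K; exact/asboolP. Qed.

Lemma smyth_le_anti : antisymmetric smyth_le.
Proof.
by move=> K L /andP[/asboolP LK /asboolP KL]; apply: ksat_inj; exact/seteqP.
Qed.

Lemma smyth_le_trans : transitive smyth_le.
Proof.
move=> L K M /asboolP LK /asboolP ML; apply/asboolP.
exact: subset_trans ML LK.
Qed.

Fact smyth_display : Order.disp_t. Proof. exact: Order.Disp tt tt. Qed.

HB.instance Definition _ := Order.Le_isPOrder.Build smyth_display (Ksat X)
  smyth_le_refl smyth_le_anti smyth_le_trans.

Definition box (U : set X) : set (Ksat X) := [set K | ksat K `<=` U].

Lemma box_cover : \bigcup_(U in open) box U = setT.
Proof. by rewrite -subTset => K _; exists setT; [exact: openT|]. Qed.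

Lemma box_join (U V : set X) K : open U -> open V -> box U K -> box V K ->
  exists W, [/\ open W, box W K & box W `<=` box U `&` box V].
Proof.
move=> oU oV KU KV; exists (U `&` V); split; first exact: openI.
  by move=> x Kx; split; [exact: KU|exact: KV].
by move=> L LUV; split=> x /LUV[].
Qed.

End Ksat.

(* Ksat X with the topology whose base is {box U | U open}. *)
Definition upper_vietoris (X : topologicalType) : Type := Ksat X.

HB.instance Definition _ (X : topologicalType) :=
  Choice.on (upper_vietoris X).
HB.instance Definition _ (X : topologicalType) :=
  isBaseTopological.Build (upper_vietoris X) box_cover box_join.

Section Spaces.
Context (Y : topologicalType).

Definition spec_le (x y : Y) := closure [set y] x.

Definition spec_up (u : Y) : set Y := [set y | spec_le u y].

Definition c_space :=
  forall (y : Y) (U : set Y), open_nbhs y U ->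
    exists u, (spec_up u)° y /\ spec_up u `<=` U.

Definition irreducible (A : set Y) :=
  A !=set0 /\
  forall B C, closed B -> closed C -> A `<=` B `|` C -> A `<=` B \/ A `<=` C.

Definition sober :=
  forall A : set Y, closed A -> irreducible A -> exists! x, A = closure [set x].

End Spaces.

(* Main.v *)
Require Import Defs.
From mathcomp Require Import all_boot all_order.
From mathcomp Require Import all_classical.
From mathcomp Require Import topology_structure compact.

(** Two properties of the space X = Sigma P carry all three conclusions: every
    point has a neighbourhood base of compact saturated sets, and X is
    well-filtered, which means that an open set containing the intersection of
    a filtered family of compact saturated sets already contains one of them.

    Well-filteredness makes Ksat X a dcpo whose directed suprema are
    intersections (ksat_bigcap), and makes every box U Scott open
    (scott_open_box). Local compactness passes from points to compact sets
    (compact_interpolation), so each K is the supremum of the directed family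
    ksat_below K of those L with K inside the interior of L
    (directed_ksat_below, isLub_ksat_below). This family is exactly
    [{ L | L << K }], which gives continuity; infima are binary unions. A Scott
    open set containing K must contain some L of ksat_below K, hence contains
    the box of the interior of L, which in turn contains K: this shows at once
    that boxes form a base of the Scott topology and that the Scott power space
    is a c-space. For sobriety, the L with K inside the interior of L for some
    K of an irreducible closed set form a directed set, and its supremum
    generates the closed set.

    For a quasicontinuous domain P both properties come from Rudin's lemma,
    in the following form (rudin_inaccessible): if FF is a Smyth-filtered
    family of finite sets, and V is an upper set met by every directed set
    whose supremum lies in all the sets up F, then V contains some F of FF.
    With V = up F it shows that [{ x | F << x }] is Scott open, so x is an
    interior point of up F whenever F << x; with V Scott open it shows that
    the sets up F, for F finite, form a neighbourhood base
    (locally_hypercompact). Finally a filtered family of compact saturated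
    sets can be replaced by the finite F such that up F is a neighbourhood of
    a member of the family, and Rudin's lemma gives well-filteredness
    (well_filtered_scott). *)

Set Implicit Arguments.
Unset Strict Implicit.
Unset Printing Implicit Defensive.

Import Order.TTheory.
Local Open Scope order_scope.
Local Open Scope classical_set_scope.

(** * Upper sets, the way-below relation and the Scott topology *)

Section UpperSets.
Context {d : Order.disp_t} {P : porderType d}.
Implicit Types (x y : P) (A B F G U V : set P).

Lemma up_upper A : upper_set (up A).
Proof. by move=> x y [a Aa ax] xy; exists a => //; exact: le_trans xy. Qed.

Lemma sub_up A : A `<=` up A.
Proof. by move=> a Aa; exists a. Qed.

Lemma up_subset A U : upper_set U -> A `<=` U -> up A `<=` U.
Proof. by move=> Uup AU y [a /AU Ua]; exact: Uup. Qed.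

Lemma up0 : up (@set0 P) = set0.
Proof. by rewrite -subset0 => y []. Qed.

Lemma upU A B : up (A `|` B) = up A `|` up B.
Proof.
apply/seteqP; split=> [y [a [Aa|Ba] ay]|y [[a Aa ay]|[a Ba ay]]].
- by left; exists a.
- by right; exists a.
- by exists a => //; left.
- by exists a => //; right.
Qed.

Lemma directed1 x : directed [set x].
Proof. by split=> [|_ _ -> ->]; exists x. Qed.

Lemma isLub1 x : isLub [set x] x.
Proof. by split=> [_ ->//|b]; exact. Qed.

Lemma isLub_unique A x y : isLub A x -> isLub A y -> x = y.
Proof.
by move=> [Ax xmin] [Ay ymin]; apply/eqP; rewrite eq_le xmin// ymin.
Qed.

Lemma way_below_up A x : way_below A x -> up A x.
Proof. by move=> /(_ _ _ (directed1 x) (isLub1 x) (lexx x))[_ [->]]. Qed.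

Lemma way_below_le A x y : way_below A x -> x <= y -> way_below A y.
Proof. by move=> Ax xy D s dD Ds /(le_trans xy); exact: Ax. Qed.

Lemma way_belowS A B x : A `<=` up B -> way_below A x -> way_below B x.
Proof.
move=> AB Ax D s dD Ds xs; have [z [Dz Az]] := Ax D s dD Ds xs.
by exists z; split=> //; exact: up_subset (@up_upper B) AB _ Az.
Qed.

Lemma scott_open_downC x : scott_open [set y | ~ y <= x].
Proof.
split=> [y z yx yz zx|D s dD [Ds smin] sx]; first exact/yx/(le_trans yz).
apply: contrapT => noD; apply/sx/smin => y Dy.
by apply: contrapT => yx; apply: noD; exists y.
Qed.

(** Specialization is the given order because principal ideals are Scott
    closed. *)
Lemma spec_leE (x y : scott P) : spec_le x y <-> (x : P) <= y.
Proof.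
split=> [xy|xy B]; last first.
  rewrite nbhsE => -[U [oU Ux] UB]; exists y; split=> //; apply: UB.
  by move: oU; rewrite open_scottE => -[Uup _]; exact: Uup xy.
apply: contrapT => nxy.
have oC : open ([set z : P | ~ z <= y] : set (scott P)).
  by rewrite open_scottE; exact: scott_open_downC.
by have [_ [-> /(_ (lexx y))]] := xy _ (open_nbhs_nbhs (conj oC nxy)).
Qed.

Lemma closed_scott (A : set (scott P)) : closed A ->
  (forall x y : P, A y -> x <= y -> A x) /\
  (forall (D : set P) s, directed D -> isLub D s -> D `<=` A -> A s).
Proof.
rewrite -openC open_scottE => -[Aup AS]; split=> [x y Ay xy|D s dD Ds DA].
  by apply: contrapT => nAx; exact: Aup nAx xy Ay.
by apply: contrapT => nAs; have [x [/DA ? ?]] := AS D s dD Ds nAs.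
Qed.

End UpperSets.

(** * Rudin's lemma *)

Section Rudin.
Context {d : Order.disp_t} {P : porderType d}.
Implicit Types (x y : P) (A B F G U V : set P) (FF : set (set P)).

(** Since up H is included in up F exactly when H is, this says that the sets
    up F, for F in FF, are filtered by inclusion. *)
Definition smyth_filtered FF := FF !=set0 /\
  forall F G, FF F -> FF G -> exists H, [/\ FF H, H `<=` up F & H `<=` up G].

Lemma finite_subset_bigcup_chain (T : eqType) (A : set T) (C : set (set T)) :
  finite_set A -> C !=set0 -> total_on C subset ->
  A `<=` \bigcup_(X in C) X -> exists2 X, C X & A `<=` X.
Proof.
move=> /finite_seqP[s ->] [X0 CX0] Ctot; elim: s => [|a s IHs] sC.
  by exists X0.
have [X CX sX] : exists2 X, C X & [set` s] `<=` X.
  by apply: IHs => y ys; apply: sC; rewrite /= inE (ys : y \in s) orbT.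
have [Y CY Ya] : (\bigcup_(X in C) X) a by apply: sC; rewrite /= inE eqxx.
have [XY|YX] := Ctot X Y CX CY.
- by exists Y => // y; rewrite /= inE => /orP[/eqP->//|/sX/XY].
- by exists X => // y; rewrite /= inE => /orP[/eqP->|/sX//]; exact: YX.
Qed.

(** Rudin's lemma. Zorn's lemma enlarges V to a maximal upper set W that still
    contains no member of FF; unions of chains are harmless because members of
    FF are finite. The complement D of W then meets every member of FF. By
    maximality, adding the upper set of a point x of D to W captures some F, so
    that the part of F inside D lies above x. Two such F have a common
    refinement H in FF, and a point of H inside D is above both given
    points, because D is a lower set: hence D is directed. *)
Lemma rudin FF V : smyth_filtered FF -> (forall F, FF F -> finite_set F) ->
  upper_set V -> (forall F, FF F -> ~ F `<=` V) ->
  exists D, [/\ directed D, D `<=` ~` V & forall F, FF F -> F `&` D !=set0].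
Proof.
move=> [[F0 FF0] FFdir] FFfin Vup FFV.
pose Q U := upper_set U /\ forall F, FF F -> ~ F `<=` V `|` U.
have [|M [[Mup FFM] Mmax]] := @Zorn_bigcup P Q.
  (* Q constrains the union of V and U rather than U, so that set0, the union
     of the empty chain, satisfies it. *)
  move=> C CQ Ctot; split.
    by move=> x y [U CU Ux] xy; exists U => //; exact: (CQ _ CU).1 Ux xy.
  move=> F FFF; have [->|C0] := eqVneq C set0.
    by rewrite bigcup_set0 setU0; exact: FFV.
  move=> FVC; have [|||U CU FU] := finite_subset_bigcup_chain
      (C := [set V `|` U | U in C]) (FFfin F FFF).
  - by move/set0P: C0 => [U CU]; exists (V `|` U), U.
  - move=> _ _ [A CA <-] [B CB <-].
    by have [AB|BA] := Ctot A B CA CB; [left|right]; exact: setUS.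
  - move=> x /FVC[Vx|[U CU Ux]].
      by move/set0P: C0 => [U CU]; exists (V `|` U); [exists U|left].
    by exists (V `|` U); [exists U|right].
  - by case: CU FU => W CW <-; exact: (CQ W CW).2.
have WM y z : (V `|` M) y -> y <= z -> (V `|` M) z.
  by move=> [Vy|My] yz; [left; exact: Vup yz|right; exact: Mup yz].
pose D := ~` (V `|` M).
have meetsD F : FF F -> F `&` D !=set0.
  move=> FFF; apply: contrapT => FD; apply: (FFM F FFF) => y Fy.
  by apply: contrapT => nWy; apply: FD; exists y.
have capture x : D x -> exists2 F, FF F & F `&` D `<=` up [set x].
  move=> Dx; apply: contrapT => noF; apply: (Mmax (M `|` up [set x])).
    split; first exact: subsetUl.
    by move=> /(_ x (or_intror (sub_up erefl))) Mx; apply: Dx; right.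
  split; first by move=> y z [My|xy] yz;
    [left; exact: Mup yz|right; exact: up_upper yz].
  move=> F FFF FVM; apply: noF; exists F => // y [/FVM[Vy|[My|//]] Dy].
  - by case: Dy; left.
  - by case: Dy; right.
exists D; split=> //; last by move=> x Dx Vx; apply: Dx; left.
split; first by have [x [_ Dx]] := meetsD _ FF0; exists x.
move=> x y Dx Dy.
have [F FFF Fx] := capture x Dx; have [G FFG Gy] := capture y Dy.
have [H [FFH HF HG]] := FFdir F G FFF FFG.
have [z [Hz Dz]] := meetsD H FFH; exists z; split=> //.
- have [f Ff fz] := HF z Hz.
  have [|_ -> xf] := Fx f; last exact: le_trans fz.
  by split=> // Wf; exact: Dz (WM _ _ Wf fz).
- have [g Gg gz] := HG z Hz.
  have [|_ -> yg] := Gy g; last exact: le_trans gz.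
  by split=> // Wg; exact: Dz (WM _ _ Wg gz).
Qed.

(** Otherwise Rudin's lemma yields a directed set that avoids V but meets every
    F of FF, so that its supremum lies in every up F. *)
Lemma rudin_inaccessible FF V : dcpo P -> smyth_filtered FF ->
  (forall F, FF F -> finite_set F) -> upper_set V ->
  (forall D s, directed D -> isLub D s ->
    (\bigcap_(F in FF) up F) s -> D `&` V !=set0) ->
  exists2 F, FF F & F `<=` V.
Proof.
move=> Pdcpo FFfilt FFfin Vup Vacc; apply: contrapT => noF.
have [|D [dD DV FFD]] := rudin FFfilt FFfin Vup.
  by move=> F FFF FV; apply: noF; exists F.
have [s Ds] := Pdcpo D dD.
have [|x [/DV]//] := Vacc D s dD Ds.
move=> F /FFD[x [Fx Dx]]; exists x => //; exact: Ds.1.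
Qed.

End Rudin.

(** * Neighbourhoods in a quasicontinuous domain *)

Section QuasicontinuousDomain.
Context {d : Order.disp_t} {P : porderType d}.
Hypothesis Pq : quasicontinuous_domain P.
Implicit Types (x y : P) (F G U V : set P).

Let Pdcpo : dcpo P := Pq.1.

Lemma fin_way_below_filtered x : smyth_filtered (fin_way_below x).
Proof.
have [ne dir _] := Pq.2 x; split=> // F G Fx Gx.
have [H [Hx HF HG]] := dir F G Fx Gx.
by exists H; split=> //; exact: subset_trans (@sub_up _ _ _) _.
Qed.

(** If s is the supremum of D, the finite sets way below some element of D form
    a filtered family whose up-sets intersect in the upper bounds of D, that is,
    in up [set s]. As F << s, the set up F fulfils the hypothesis of
    rudin_inaccessible, so that some G way below an element of D lies in
    up F. *)
Lemma scott_open_way_below F : scott_open [set x | way_below F x].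
Proof.
split=> [x y|D s dD Ds Fs]; first exact: way_below_le.
pose GG := \bigcup_(x in D) fin_way_below x.
have [||||G [x Dx [_ Gx]] GF] := @rudin_inaccessible _ _ GG (up F) Pdcpo.
- split.
    have [x Dx] := dD.1; have [[G Gx] _] := fin_way_below_filtered x.
    by exists G, x.
  move=> G1 G2 [x Dx [fG1 G1x]] [y Dy [fG2 G2y]].
  have [z [Dz xz yz]] := dD.2 x y Dx Dy.
  have [_ /(_ G1 G2)[||H [Hz HG1 HG2]]] := fin_way_below_filtered z.
  + by split=> //; exact: way_below_le xz.
  + by split=> //; exact: way_below_le yz.
  by exists H; split=> //; exists z.
- by move=> G [x _ []].
- exact: up_upper.
- move=> E t dE Et GGt; apply: (Fs E t dE Et); apply: Ds.2 => x Dx.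
  have [_ _ xcap] := Pq.2 x.
  have : (\bigcap_(G in fin_way_below x) up G) t.
    by move=> G Gx; apply: GGt; exists x.
  by rewrite xcap => -[_ ->].
- by exists x; split=> //=; exact: way_belowS GF Gx.
Qed.

Lemma way_below_interior F x : way_below F x -> ((up F : set (scott P))°) x.
Proof.
move=> Fx; rewrite /interior nbhsE; exists [set y | way_below F y].
  by split=> //; rewrite open_scottE; exact: scott_open_way_below.
by move=> y; exact: way_below_up.
Qed.

(** The sets up F for F << x intersect in up [set x], which is inside U, and
    each of them is a neighbourhood of x; Rudin's lemma finds one inside U. *)
Lemma locally_hypercompact U x : scott_open U -> U x ->
  exists F, [/\ finite_set F, ((up F : set (scott P))°) x & up F `<=` U].
Proof.
move=> [Uup US] Ux.
have [||||F [fF Fx] FU] := @rudin_inaccessible _ _ (fin_way_below x) U Pdcpo.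
- exact: fin_way_below_filtered.
- by move=> F [].
- exact: Uup.
- move=> D s dD Ds; have [_ _ ->] := Pq.2 x => -[_ -> xs].
  exact: US dD Ds (Uup _ _ Ux xs).
- exists F; split=> //; first exact: way_below_interior.
  exact: up_subset.
Qed.

End QuasicontinuousDomain.


(** * Compact and saturated sets *)

Section CompactSaturated.
Context {X : topologicalType}.
Implicit Types (A B U : set X) (K L : Ksat X).

(** Finite unions being absorbed by directedness, a single member suffices: if
    none did, the sets A minus U would generate a proper filter, and a cluster
    point of it in A would lie in no member of OO. *)
Lemma compact_directed_cover A (OO : set (set X)) :
  compact A -> OO !=set0 -> OO `<=` open ->
  (forall U V, OO U -> OO V -> exists2 W, OO W & U `|` V `<=` W) ->
  A `<=` \bigcup_(U in OO) U -> exists2 U, OO U & A `<=` U.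
Proof.
move=> Ac [U0 OU0] OOo OOdir Acov; apply: contrapT => noU.
have G : ProperFilter (filter_from OO (fun U => A `\` U)).
  apply: filter_from_proper.
    apply: filter_from_filter; first by exists U0.
    move=> U V OU OV; have [W OW UVW] := OOdir U V OU OV.
    exists W => // x [Ax nWx].
    by split; split=> // ?; apply/nWx/UVW; [left|right].
  move=> U OU; apply: contrapT => AU; apply: noU; exists U => // x Ax.
  by apply: contrapT => nUx; apply: AU; exists x.
have [|x [Ax clx]] := Ac _ G; first by exists U0 => // x [].
have [U OU Ux] := Acov x Ax.
have [||y [[_]]//] := clx (A `\` U) U; first by exists U.
by apply: open_nbhs_nbhs; split=> //; exact: OOo.
Qed.

(** The sets satisfying Q may be thought of as a base of neighbourhoods closed
    under finite unions. It is used both with Q the compact saturated sets and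
    with Q the sets up F for F finite. *)
Lemma compact_interpolation (Q : set (set X)) A U :
  Q set0 -> (forall B C, Q B -> Q C -> Q (B `|` C)) ->
  (forall x, U x -> exists B, [/\ Q B, B° x & B `<=` U]) ->
  compact A -> A `<=` U -> exists B, [/\ Q B, A `<=` B° & B `<=` U].
Proof.
move=> Q0 QU Qbase Ac AU.
have [||||_ [B [QB BU] <-] AB] := @compact_directed_cover A
    [set B° | B in [set B | Q B /\ B `<=` U]] Ac.
- by exists (set0°), set0; split=> //; exact: sub0set.
- by move=> _ [B _ <-]; exact: open_interior.
- move=> _ _ [B [QB BU] <-] [C [QC CU] <-]; exists ((B `|` C)°).
    by exists (B `|` C) => //; split; [exact: QU|rewrite subUset].
  exact: interiorU.
- move=> x /AU/Qbase[B [QB Bx BU]]; exists (B°) => //.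
  by exists B.
- by exists B.
Qed.

(** A saturated set is the intersection of all its open neighbourhoods, so the
    family witnessing saturation can be taken to be canonical. *)
Lemma saturatedP A : saturated A <->
  forall x, (forall U, open U -> A `<=` U -> U x) -> A x.
Proof.
split=> [[O Oo ->] x xO U OU|Asat].
  by apply: xO; [exact: Oo|exact: bigcap_inf].
exists [set U | open U /\ A `<=` U]; first by move=> U [].
apply/seteqP; split=> [x Ax U [_]|x xO]; first exact.
by apply: Asat => U oU AU; exact: xO.
Qed.

Lemma saturated_bigcap (AA : set (set X)) :
  AA `<=` saturated -> saturated (\bigcap_(A in AA) A).
Proof.
move=> AAs; apply/saturatedP => x xU A AAA.
have /saturatedP := AAs A AAA; apply => U oU AU.
by apply: xU oU _ => y /(_ A AAA)/AU.
Qed.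

Lemma saturatedU A B : saturated A -> saturated B -> saturated (A `|` B).
Proof.
move=> /saturatedP As /saturatedP Bs; apply/saturatedP => x xU.
apply: contrapT => /not_orP[nAx nBx]; apply: nAx; apply: As => U oU AU.
apply: contrapT => nUx; apply: nBx; apply: Bs => V oV BV.
have [//|//] : (U `|` V) x.
by apply: xU; [exact: openU|exact: setUSS].
Qed.

Lemma ksat_leP K L : reflect ((L : set X) `<=` K) (K <= L).
Proof. exact: asboolP. Qed.

Definition well_filtered := forall (D : set (Ksat X)) U, directed D ->
  open U -> \bigcap_(K in D) (K : set X) `<=` U ->
  exists2 K, D K & (K : set X) `<=` U.

(** Local compactness in the sense appropriate to non-Hausdorff spaces, where
    compact neighbourhoods need not be closed and must be required inside every
    open neighbourhood. *)
Definition locally_ksat := forall x U, open U -> U x ->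
  exists A, [/\ compact A, saturated A, A° x & A `<=` U].

End CompactSaturated.
Arguments well_filtered : clear implicits.
Arguments locally_ksat : clear implicits.

(** * The power space of a locally compact well-filtered space *)

Section WellFiltered.
Context {X : topologicalType}.
Hypothesis Xwf : well_filtered X.
Implicit Types (U : set X) (K L M : Ksat X) (D : set (Ksat X)).

(** The intersection M is nonempty, since otherwise some member of D would be
    included in the open set set0. It is compact: if a filter containing M had
    no cluster point in M, the open complement of its cluster set would contain
    M, hence some K of D; but K belongs to the filter, so that its compactness
    provides a cluster point in K. *)
Lemma ksat_bigcap D : directed D ->
  exists M, (M : set X) = \bigcap_(K in D) (K : set X).
Proof.
move=> dD; set M := \bigcap_(K in D) _.
have M0 : M !=set0.
  apply: contrapT => M0; have [|K DK] := Xwf dD open0.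
    by move=> x Mx; apply: M0; exists x.
  by have [x /[swap]/[apply]] := ksat_neq0 K.
have Mc : compact M.
  move=> F PF FM; apply: contrapT => noclu.
  have ocl : open (~` cluster F).
    by rewrite openC clusterE; apply: closed_bigI => A _; exact: closed_closure.
  have [|K DK Kcl] := Xwf dD ocl.
    by move=> x Mx clx; apply: noclu; exists x.
  have [|x [/Kcl]//] := @ksat_compact _ K F PF.
  by apply: filterS FM => x; exact.
have Ms : saturated M.
  have -> : M = \bigcap_(A in [set (K : set X) | K in D]) A.
    by rewrite bigcap_image.
  by apply: saturated_bigcap => _ [K _ <-]; exact: ksat_saturated.
by exists (MkKsat M0 Mc Ms).
Qed.

Lemma isLub_ksat_bigcap D M :
  (M : set X) = \bigcap_(K in D) (K : set X) -> isLub D M.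
Proof.
move=> ME; split=> [K DK|L LD]; apply/ksat_leP; rewrite ME.
  exact: bigcap_inf.
by move=> x Lx K /LD/ksat_leP; exact.
Qed.

Lemma ksat_dcpo : dcpo (Ksat X).
Proof.
by move=> D /ksat_bigcap[M ME]; exists M; exact: isLub_ksat_bigcap.
Qed.

(** Suprema being unique, a directed supremum in Ksat X can only be the
    intersection. *)
Lemma isLub_ksatE D M : directed D -> isLub D M ->
  (M : set X) = \bigcap_(K in D) (K : set X).
Proof.
move=> dD DM; have [N NE] := ksat_bigcap dD.
by rewrite -NE (isLub_unique DM (isLub_ksat_bigcap NE)).
Qed.

Lemma scott_open_box U : open U -> scott_open (box U).
Proof.
move=> oU; split=> [K L KU /ksat_leP LK|D M dD DM MU].
  exact: subset_trans KU.
have [|K DK KU] := Xwf dD oU; first by rewrite -(isLub_ksatE dD DM).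
by exists K.
Qed.

Hypothesis Xloc : locally_ksat X.

(** The way-below relation of Ksat X, described topologically; see
    way_below_ksatE. *)
Definition ksat_below K : set (Ksat X) := [set L | (K : set X) `<=` L°].

Lemma ksat_interpolation K U : open U -> (K : set X) `<=` U ->
  exists2 L, ksat_below K L & (L : set X) `<=` U.
Proof.
move=> oU KU.
have [||x Ux|A [[Ac As] KA AU]] := @compact_interpolation _
    [set A | compact A /\ saturated A] K U _ _ _ (@ksat_compact _ K) KU.
- split; first exact: compact0.
  by exists [set set0]; [move=> _ ->; exact: open0|rewrite bigcap_set1].
- move=> B C [Bc Bs] [Cc Cs].
  by split; [exact: compactU|exact: saturatedU].
- by have [A [Ac As Ax AU]] := Xloc oU Ux; exists A.
have A0 : A !=set0.
  by have [x /KA/interior_subset Ax] := ksat_neq0 K; exists x.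
by exists (MkKsat A0 Ac As).
Qed.

Lemma directed_ksat_below K : directed (ksat_below K).
Proof.
split; first by have [|L KL] := @ksat_interpolation K _ openT; [|exists L].
move=> L M KL KM; have oLM : open ((L : set X)° `&` (M : set X)°).
  by apply: openI; exact: open_interior.
have [|N KN NLM] := ksat_interpolation oLM (K := K).
  by move=> x Kx; split; [exact: KL|exact: KM].
by exists N; split=> //; apply/ksat_leP => x /NLM[];
  [move=> + _|move=> _]; exact: interior_subset.
Qed.

(** The members of ksat_below K intersect in K because K is the intersection of
    its open neighbourhoods, each of which contains such a member. *)
Lemma isLub_ksat_below K : isLub (ksat_below K) K.
Proof.
apply: isLub_ksat_bigcap; apply/seteqP; split=> [x Kx L KL|x Kx].
  exact: interior_subset (KL x Kx).
have /saturatedP := ksat_saturated K; apply=> U oU KU.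
by have [L KL LU] := ksat_interpolation oU KU; exact/LU/Kx.
Qed.

(** From left to right, the definition of L << K is applied to ksat_below K,
    whose supremum is K; from right to left, well-filteredness is applied to
    the interior of L. *)
Lemma way_below_ksatE K : [set L | way_below [set L] K] = ksat_below K.
Proof.
apply/seteqP; split=> [L LK|L KL D M dD DM /ksat_leP MK].
  have [M [KM [_ -> /ksat_leP ML]]] :=
    LK _ _ (directed_ksat_below K) (isLub_ksat_below K) (lexx K).
  exact: subset_trans KM (interiorS ML).
have [|N DN NL] := Xwf dD (open_interior L).
  by rewrite -(isLub_ksatE dD DM); exact: subset_trans KL.
exists N; split=> //; exists L => //.
by apply/ksat_leP => x /NL/interior_subset.
Qed.

Lemma ksat_continuous_semilattice : continuous_semilattice (Ksat X).
Proof.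
split; first split; first exact: ksat_dcpo.
  move=> K; rewrite way_below_ksatE.
  by split; [exact: directed_ksat_below|exact: isLub_ksat_below].
move=> K L; have KL0 : ((K : set X) `|` L) !=set0.
  by have [x Kx] := ksat_neq0 K; exists x; left.
pose KL := MkKsat KL0 (compactU (@ksat_compact _ K) (@ksat_compact _ L))
  (saturatedU (@ksat_saturated _ K) (@ksat_saturated _ L)).
exists KL; split=> [M [->|->]|M MKL]; apply/ksat_leP; rewrite /KL/=.
- exact: subsetUl.
- exact: subsetUr.
- by rewrite subUset; split; apply/ksat_leP; apply: MKL; [left|right].
Qed.

Lemma scott_open_ksat_below (A : set (Ksat X)) K :
  scott_open A -> A K -> exists2 L, ksat_below K L & A L.
Proof.
move=> [_ Aacc] /(Aacc _ _ (directed_ksat_below K) (isLub_ksat_below K)).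
by move=> [L [KL AL]]; exists L.
Qed.

(** If K belongs to a Scott open A, some L of ksat_below K does; the box of its
    interior contains K, and lies in A since its elements are above L. *)
Lemma upper_vietorisE (A : set (Ksat X)) :
  @open (upper_vietoris X) A <-> @open (scott (Ksat X)) A.
Proof.
rewrite open_scottE; split=> [[OO OOo <-]|Ao].
  split=> [K L [U OU KU] /(scott_open_box (OOo U OU)).1|D M dD DM [U OU MU]].
    by move=> /(_ KU) LU; exists U.
  have [K [DK KU]] := (scott_open_box (OOo U OU)).2 D M dD DM MU.
  by exists K; split=> //; exists U.
exists [set U | open U /\ box U `<=` A]; first by move=> U [].
apply/seteqP; split=> [K [U [_]]|K AK]; first exact.
have [L KL AL] := scott_open_ksat_below Ao AK.
exists (L°) => //; split; first exact: open_interior.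
move=> M ML; apply: Ao.1 AL _; apply/ksat_leP => x /ML; exact: interior_subset.
Qed.

Lemma ksat_c_space : c_space (scott (Ksat X)).
Proof.
move=> K A [oA AK]; move: oA; rewrite open_scottE => oA.
have [L KL AL] := scott_open_ksat_below oA AK; exists L; split.
  rewrite /interior nbhsE; exists (box (L : set X)°).
    split=> //; rewrite open_scottE; exact: scott_open_box (open_interior _).
  move=> M ML; apply/spec_leE/ksat_leP => x /ML; exact: interior_subset.
by move=> M /spec_leE LM; exact: oA.1 AL LM.
Qed.

(** The argument that continuous domains are sober: by irreducibility, if A
    meets the open boxes of the interiors of L and of M, it meets both in a
    common point T, and a bound of L and M in ksat_below T keeps the set D
    directed. Its supremum S is in A because A is Scott closed, and S is above
    each K of A because K is the supremum of ksat_below K. *)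
Lemma ksat_sober : sober (scott (Ksat X)).
Proof.
move=> A Acl [[K0 AK0] Airr].
have [Adown Asup] := closed_scott Acl.
pose D : set (Ksat X) := \bigcup_(K in A) ksat_below K.
have closedCbox L : closed (~` box (L : set X)° : set (scott (Ksat X))).
  apply: open_closedC; rewrite open_scottE.
  exact: scott_open_box (open_interior _).
have dD : directed D.
  split.
    by have [[L K0L] _] := directed_ksat_below K0; exists L, K0.
  move=> L M [K AK KL] [N AN NM].
  have [T AT [TL TM]] : exists2 T, A T & ksat_below T L /\ ksat_below T M.
    apply: contrapT => noT.
    have [T AT|AL|AM] := Airr _ _ (closedCbox L) (closedCbox M).
    - apply: contrapT => /not_orP[/contrapT TL /contrapT TM].
      by apply: noT; exists T.
    - exact: AL AK KL.
    - exact: AM AN NM.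
  have [S [TS LS MS]] := (directed_ksat_below T).2 L M TL TM.
  by exists S; split=> //; exists T.
have [S DS] := ksat_dcpo dD.
have AS : A S.
  apply: (Asup D) => // L [K AK KL]; apply: Adown AK _.
  by apply/ksat_leP => x /KL; exact: interior_subset.
have ASE : A = closure [set S : scott (Ksat X)].
  apply/seteqP; split=> [K AK|K /spec_leE KS]; last exact: Adown AS KS.
  apply/spec_leE; apply: (isLub_ksat_below K).2 => L KL.
  by apply: DS.1; exists K.
exists S; split=> // T ATE; apply/eqP; rewrite eq_le.
apply/andP; split; apply/spec_leE; rewrite /spec_le.
  by rewrite -ATE.
by rewrite -ASE ATE; exact: subset_closure.
Qed.

End WellFiltered.

(** * The Scott space of a quasicontinuous domain *)

Section ScottQuasicontinuous.
Context {d : Order.disp_t} {P : porderType d}.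
Implicit Types (x y : P) (F G U V : set P).

Lemma compact_up F : finite_set F -> compact (up F : set (scott P)).
Proof.
move=> /finite_seqP[s ->]; elim: s => [|a s IHs].
  by rewrite set_nil up0; exact: compact0.
have -> : [set` a :: s] = [set a] `|` [set` s].
  by apply/predeqP => x; rewrite /= inE; split=> [/predU1P|/predU1P].
rewrite upU; apply: compactU => // FF PF FFa.
exists a; split; first exact: sub_up.
move=> A B FFA; rewrite nbhsE => -[U [oU Ua] UB].
have [x [[_ -> ax] Ax]] := filter_ex (filterI FFa FFA).
by exists x; split=> //; apply: UB; exact: oU.1 Ua ax.
Qed.

(** An upper set is the intersection of the complements of the principal ideals
    of the points outside it. *)
Lemma saturated_scott (A : set (scott P)) :
  saturated A <-> upper_set (A : set P).
Proof.
split=> [[O Oo ->] x y xO xy U OU|Aup].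
  exact: (Oo U OU).1 (xO U OU) xy.
apply/saturatedP => x xU; apply: contrapT => nAx.
apply: (xU [set y : P | ~ y <= x] _ _ (lexx (x : P))).
  by rewrite open_scottE; exact: scott_open_downC.
by move=> y Ay yx; apply: nAx; exact: Aup Ay yx.
Qed.

Hypothesis Pq : quasicontinuous_domain P.

Lemma locally_ksat_scott : locally_ksat (scott P).
Proof.
move=> x U oU Ux; have [F [fF Fx FU]] := locally_hypercompact Pq oU Ux.
exists (up F); split=> //; first exact: compact_up.
by apply/saturated_scott; exact: up_upper.
Qed.

Lemma compact_finite_interpolation (A U : set (scott P)) :
  compact A -> open U -> A `<=` U -> exists F,
    [/\ finite_set F, A `<=` (up F : set (scott P))° & up F `<=` U].
Proof.
move=> Ac oU AU.
have [||x Ux|_ [[F fF <-] AF FU]] := @compact_interpolation (scott P)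
    [set up F | F in finite_set] A U _ _ _ Ac AU.
- by exists set0; [exact: finite_set0|exact: up0].
- move=> _ _ [F fF <-] [G fG <-].
  by exists (F `|` G); [rewrite /= finite_setU|rewrite upU].
- have [F [fF Fx FU]] := locally_hypercompact Pq oU Ux.
  by exists (up F); split=> //; exists F.
by exists F.
Qed.

(** The sets up F for F in FF intersect in the intersection of D: a point t
    outside some K of D has a principal ideal disjoint from K, and
    interpolation between K and the complement of that ideal gives an F of FF
    with t outside up F. So U satisfies the hypothesis of
    rudin_inaccessible, and the F inside U that this lemma finds is such that
    up F is a neighbourhood of a member of D. *)
Lemma well_filtered_scott : well_filtered (scott P).
Proof.
move=> D U dD oU DU.
pose nbh K F := (ksat K : set (scott P)) `<=` (up F : set (scott P))°.
pose FF := [set F | finite_set F /\ exists2 K, D K & nbh K F].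
have [||||F [_ [K DK KF]] FU] := @rudin_inaccessible _ _ FF U Pq.1.
- split.
    have [K DK] := dD.1.
    have [|F [fF KF _]] :=
        compact_finite_interpolation (@ksat_compact _ K) openT.
      by [].
    by exists F; split=> //; exists K.
  move=> F G [_ [K DK KF]] [_ [L DL LG]].
  have [M [DM /ksat_leP MK /ksat_leP ML]] := dD.2 K L DK DL.
  have oFG : open ((up F : set (scott P))° `&` (up G : set (scott P))°).
    by apply: openI; exact: open_interior.
  have [|H [fH MH HFG]] := compact_finite_interpolation (@ksat_compact _ M) oFG.
    by move=> x Mx; split; [exact/KF/MK|exact/LG/ML].
  exists H; split; first by split=> //; exists M.
  + by move=> x /(@sub_up _ _ H)/HFG[/interior_subset].
  + by move=> x /(@sub_up _ _ H)/HFG[_ /interior_subset].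
- by move=> F [].
- exact: oU.1.
- move=> E t dE Et FFt; apply: oU.2 dE Et _; apply: DU => K DK.
  apply: contrapT => nKt.
  have oCt : open ([set y : P | ~ y <= t] : set (scott P)).
    by rewrite open_scottE; exact: scott_open_downC.
  have [|F [fF KF Ft]] := compact_finite_interpolation (@ksat_compact _ K) oCt.
    have /saturated_scott Kup := ksat_saturated K.
    by move=> y Ky yt; apply: nKt; exact: Kup Ky yt.
  by apply: (Ft t) => //; apply: FFt; split=> //; exists K.
- exists K => // x /KF/interior_subset; apply: up_subset => //; exact: oU.1.
Qed.

End ScottQuasicontinuous.

Theorem corollary8p7 (d : Order.disp_t) (P : porderType d)
    (hP : quasicontinuous_domain P) :
  (forall A : set (Ksat (scott P)),
     @open (upper_vietoris (scott P)) A <-> @open (scott (Ksat (scott P))) A)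
  /\ continuous_semilattice (Ksat (scott P))
  /\ (sober (scott (Ksat (scott P))) /\ c_space (scott (Ksat (scott P)))).
Proof.
have wf := well_filtered_scott hP; have loc := locally_ksat_scott hP.
split; first by move=> A; exact: upper_vietorisE.
split; first exact: ksat_continuous_semilattice.
by split; [exact: ksat_sober|exact: ksat_c_space].
Qed.
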